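(* Let $p$ and $\wp$ be odd primes and $m$ a positive integer such that $p$ is a primitive root modulo $\wp^m$. Let $q=p^{\phi(\wp^m)}$, let $g$ be a primitive element of $\mathbb{F}_q$, and let $\xi=g^{\frac{q-1}{\wp^m}}$. For any $a\in\mathbb{F}_q$, write $a=a_1\xi+a_2\xi^2+\cdots+a_{\phi(\wp^m)}\xi^{\phi(\wp^m)}$ with each $a_s\in\mathbb{F}_p$, and for each integer $i$ with $0\le i\le \wp^{m-1}-1$ let $$e_i(a)=\prod_{k=1}^{\wp-1}\zeta_p^{-\wp^{m-1}a_{k\wp^{m-1}-i}},\qquad f_i(a)=\sum_{k=1}^{\wp-1}\zeta_p^{\wp^{m}a_{k\wp^{m-1}-i}}.$$ Then $$S_{\wp^m}(a)=\sum_{i=0}^{\wp^{m-1}-1}e_i(a)\,(f_i(a)+1).$$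
   Context: $\phi$ is Euler's totient function. $\zeta_p=e^{2\pi i/p}$; for $u\in\mathbb{F}_p$, $\zeta_p^{u}$ is defined via any integer representative of $u$. ${\rm Tr}$ is the absolute trace $\mathbb{F}_q\to\mathbb{F}_p$, and $\chi(x)=e^{2\pi i{\rm Tr}(x)/p}$ is the canonical additive character of $\mathbb{F}_q$. For $a\in\mathbb{F}_q$, $S_{\wp^m}(a):=\sum_{j=0}^{\wp^m-1}\chi(a\xi^j)$. A primitive element of $\mathbb{F}_q$ is a generator of $\mathbb{F}_q^*$. The set $\{\xi,\xi^2,\ldots,\xi^{\phi(\wp^m)}\}$ is a basis of $\mathbb{F}_q$ over $\mathbb{F}_p$, so the coefficients $a_s$ are uniquely determined. *)

(* Defs.v *)
From HB Require Import structures.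
From mathcomp Require Import all_boot all_order all_algebra.
From mathcomp Require Import all_fingroup all_solvable all_field.
From mathcomp Require Import complex.
From mathcomp Require Import reals trigo.

Set Implicit Arguments.
Unset Strict Implicit.
Unset Printing Implicit Defensive.

Import Order.TTheory GRing.Theory Num.Theory.
Local Open Scope ring_scope.

Definition primitive_root_mod (n g : nat) : Prop :=
  coprime g n /\
  forall b : nat, coprime b n -> exists k : nat, (g ^ k = b %[mod n])%N.

(* e^{it} for real t. *)
Definition expi (R : realType) (t : R) : R[i] := Complex (cos t) (sin t).

Definition zeta (R : realType) (p : nat) : R[i] := expi (2 * pi / p%:R).

(* The coercion of u : 'F_p to nat is its representative in 0, ..., p - 1. *)
Definition zeta_pow (R : realType) (p : nat) (u : 'F_p) : R[i] :=
  zeta R p ^+ u.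

Section FiniteField.

(* [pPrimeCharType charF] is F itself, as an extension of 'F_p. *)
Variables (p : nat) (F : finFieldType) (charF : p \in [pchar F]).

(* [galTrace] takes its values in the prime subfield of F, i.e., in the set of
   the t%:A for t : 'F_p; the default 0 is never used. *)
Definition abs_trace (x : pPrimeCharType charF) : 'F_p :=
  odflt 0 [pick t : 'F_p |
    t%:A == galTrace 1%AS {:pPrimeCharType charF}%AS x].

Definition add_char (R : realType) (x : pPrimeCharType charF) : R[i] :=
  expi (2 * pi * (abs_trace x : nat)%:R / p%:R).

Definition char_sum (R : realType) (xi : pPrimeCharType charF) (n : nat)
    (a : pPrimeCharType charF) : R[i] :=
  \sum_(0 <= j < n) add_char R (a * xi ^+ j).

End FiniteField.

(* In [e_coef] and [f_coef], c s is the coefficient of xi ^+ s for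
   1 <= s <= totient (l ^ m). The index k * l ^ m.-1 - i lies in that range
   when 1 <= k < l and i < l ^ m.-1, so the subtraction is not truncated. *)
Definition e_coef (R : realType) (p l m : nat) (c : nat -> 'F_p) (i : nat) :
    R[i] :=
  \prod_(1 <= k < l)
    zeta_pow R (- ((l ^ m.-1)%N%:R * c (k * l ^ m.-1 - i)%N)).

Definition f_coef (R : realType) (p l m : nat) (c : nat -> 'F_p) (i : nat) :
    R[i] :=
  \sum_(1 <= k < l)
    zeta_pow R ((l ^ m)%N%:R * c (k * l ^ m.-1 - i)%N).

(* Main.v *)
Require Import Defs.
From HB Require Import structures.
From mathcomp Require Import all_boot all_order all_algebra.
From mathcomp Require Import all_fingroup all_solvable all_field.
From mathcomp Require Import complex.
From mathcomp Require Import reals trigo.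

(** Write n = l ^ m and q = l ^ m.-1.  The Galois group of F over 'F_p is
    generated by the Frobenius map, and the powers of p run over the units
    modulo n, so the conjugates of xi are all the primitive n-th roots of
    unity.  Hence the trace of xi ^+ t is a Ramanujan sum, equal to
    n [n | t] - q [q | t]: the sum over all n-th roots of unity minus the sum
    over those that are l-th powers ([prim_root_sum_coprime],
    [abs_trace_prim_root]).

    Decompose j < n as j = i + r q with i < q and r < l, and expand
    a * xi ^+ j on the powers of xi.  Only the exponents s with q | s + i
    contribute to the trace; in the range 1 <= s <= totient n = (l - 1) q they
    are the numbers k q - i with 1 <= k < l ([sum_shifted_multiples]).  The
    corresponding power of xi is xi ^+ ((k + r) q), so each k contributes
    - q c_(k q - i), and the extra term n c_(k q - i) occurs only when l
    divides k + r, i.e., for k = l - r, which requires r > 0.  Thus the term j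
    of the character sum is e_i for r = 0, and e_i times the summand of index
    l - r of f_i for r > 0; summing over r gives e_i (f_i + 1). *)

Set Implicit Arguments.
Unset Strict Implicit.
Unset Printing Implicit Defensive.

Import Order.TTheory GRing.Theory Num.Theory.
Local Open Scope ring_scope.

(** * Sums of powers of roots of unity *)

(** Both lists have totient n entries, and the first one contains the second
    since g is a primitive root; so the first one has no repetition either. *)
Lemma primitive_root_powers_perm (n g : nat) :
  (0 < n)%N -> primitive_root_mod n g ->
  perm_eq [seq (g ^ k %% n)%N | k <- iota 0 (totient n)]
          [seq b <- iota 0 n | coprime b n].
Proof.
move=> n_gt0 [co_gn root_g].
set s1 := map _ _; set s2 := filter _ _.
have size_s2 : size s2 = totient n.
  rewrite totient_count_coprime size_filter -sum1_count big_mkcond /=.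
  rewrite /index_iota subn0; apply: eq_bigr => b _.
  by rewrite coprime_sym; case: coprime.
have size_s1 : size s1 = totient n by rewrite size_map size_iota.
have uniq_s2 : uniq s2 by rewrite filter_uniq ?iota_uniq.
have sub21 : {subset s2 <= s1}.
  move=> b; rewrite mem_filter mem_iota add0n => /and3P[co_bn _ lt_bn].
  have [k gk_b] := root_g b co_bn; apply/mapP; exists (k %% totient n)%N.
    by rewrite mem_iota add0n ltn_mod totient_gt0 n_gt0.
  (* The exponent k only matters modulo totient n, by Euler's theorem. *)
  rewrite -(modn_small lt_bn) -gk_b {1}(divn_eq k (totient n)) expnD mulnC.
  rewrite [(_ %/ _ * _)%N]mulnC expnM -modnMmr -modnXm.
  by rewrite Euler_exp_totient // modnXm exp1n modnMmr muln1.
have le12 : (size s1 <= size s2)%N by rewrite size_s1 size_s2.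
have uniq_s1 : uniq s1 := leq_size_uniq uniq_s2 sub21 le12.
have [_ eq12] := uniq_min_size uniq_s2 sub21 le12.
by apply: uniq_perm => // b; rewrite eq12.
Qed.

Lemma prim_root_sum_powers (K : fieldType) (n : nat) (z : K) (t : nat) :
  n.-primitive_root z ->
  \sum_(0 <= b < n) z ^+ (t * b) = n%:R *+ (n %| t).
Proof.
move=> prim_z; rewrite (prim_order_dvd prim_z).
under eq_bigr do rewrite exprM.
have [->|zt_neq1] := eqVneq (z ^+ t) 1.
  under eq_bigr do rewrite expr1n.
  by rewrite sumr_const_nat subn0.
have /(congr1 (fun x => x == 0)) := subrX1 (z ^+ t) n.
rewrite exprAC (prim_expr_order prim_z) expr1n subrr eqxx mulf_eq0 subr_eq0.
by rewrite (negPf zt_neq1) /= big_mkord => /esym/eqP.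
Qed.

(** This evaluates the Ramanujan sum of a prime power: being coprime to l ^ m
    means not being a multiple of l, and the sum over the multiples of l is the
    full sum of powers of z ^+ l, which has order l ^ m.-1. *)
Lemma prim_root_sum_coprime (K : fieldType) (l m : nat) (z : K) (t : nat) :
  prime l -> (0 < m)%N -> (l ^ m).-primitive_root z ->
  \sum_(0 <= b < l ^ m | coprime b (l ^ m)) z ^+ (t * b) =
    (l ^ m)%:R *+ (l ^ m %| t) - (l ^ m.-1)%:R *+ (l ^ m.-1 %| t).
Proof.
move=> l_prime m_gt0 prim_z.
have l_gt0 := prime_gt0 l_prime.
have nE : (l ^ m = l ^ m.-1 * l)%N by rewrite -expnSr prednK.
have prim_zl : (l ^ m.-1).-primitive_root (z ^+ l).
  have := dvdn_prim_root prim_z (dvdn_exp2l l (leq_pred m)).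
  by rewrite {1}nE mulKn ?expn_gt0 ?l_gt0.
have coprimeE b : coprime b (l ^ m) = ~~ (l %| b)%N.
  by rewrite coprime_sym coprime_pexpl // prime_coprime.
rewrite -(prim_root_sum_powers t prim_z) -(prim_root_sum_powers t prim_zl).
rewrite [X in _ = X - _](bigID (fun b => l %| b)%N) /= addrAC.
rewrite [X in _ = X + _](_ : _ = 0) ?add0r; last first.
  apply/eqP; rewrite subr_eq0; apply/eqP.
  (* In each block of l consecutive integers, only the first is a multiple
     of l. *)
  rewrite [LHS]big_mkcond [in LHS]nE [LHS]big_nat_mul; apply: eq_bigr => b _.
  rewrite -{1}[(b * l)%N]add0n big_addn mulSn addnK.
  rewrite big_ltn //= add0n dvdn_mull // big_nat big1 ?addr0.
    by rewrite -exprM mulnA mulnC.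
  move=> i /andP[i_gt0 i_lt]; rewrite dvdn_addl ?dvdn_mull //.
  by rewrite gtnNdvd.
by apply: eq_bigl => b; rewrite coprimeE.
Qed.

Lemma generator_prim_root (F : finFieldType) (g : {unit F}) :
  generator [set: {unit F}] g -> (#|F| - 1).-primitive_root (val g).
Proof.
move=> g_gen; have -> : (#|F| - 1)%N = #[g]%g.
  by rewrite subn1 -card_finField_unit (eqP g_gen).
apply/andP; split; first exact: order_gt0.
apply/forallP=> i; rewrite unity_rootE -FinRing.val_unitX.
rewrite -FinRing.val_unit1 val_eqE -order_dvdn.
apply/eqP; apply/idP/eqP => [|->//].
by move/dvdn_leq=> /(_ isT) le_gi; apply/eqP; rewrite eqn_leq ltn_ord.
Qed.

(** * The additive character *)

Lemma expiD (R : realType) (s t : R) : expi (s + t) = expi s * expi t.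
Proof.
apply/eqP; rewrite /expi cosD sinD eq_complex /= eqxx /=.
by rewrite addrC.
Qed.

Lemma expiX (R : realType) (t : R) (k : nat) : expi (t * k%:R) = expi t ^+ k.
Proof.
elim: k => [|k IHk]; first by rewrite mulr0 /expi cos0 sin0.
by rewrite mulrSr mulrDr mulr1 expiD IHk exprSr.
Qed.

Lemma zetaXp (R : realType) (p : nat) : (0 < p)%N -> zeta R p ^+ p = 1.
Proof.
move=> p_gt0; rewrite /zeta -expiX divfK ?pnatr_eq0 -?lt0n //.
by rewrite mulr_natl /expi cos2pi sin2pi.
Qed.

Section ZetaPow.

Variables (R : realType) (p : nat).
Hypothesis p_prime : prime p.

Lemma zeta_pow0 : zeta_pow R (0 : 'F_p) = 1.
Proof. by []. Qed.

(** The sum in 'F_p is reduced modulo p, which is harmless because zeta is a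
    p-th root of unity. *)
Lemma zeta_powD (u v : 'F_p) :
  zeta_pow R (u + v) = zeta_pow R u * zeta_pow R v.
Proof.
rewrite /zeta_pow -exprD /= [X in (_ %% X)%N](Fp_cast p_prime).
by rewrite expr_mod // zetaXp ?prime_gt0.
Qed.

Lemma zeta_pow_sum (I : Type) (r : seq I) (P : pred I) (u : I -> 'F_p) :
  zeta_pow R (\sum_(i <- r | P i) u i) = \prod_(i <- r | P i) zeta_pow R (u i).
Proof. exact: (big_morph _ zeta_powD zeta_pow0). Qed.

End ZetaPow.

(** * The absolute trace *)

Section Trace.

Variables (p : nat) (F : finFieldType) (charF : p \in [pchar F]).
Local Notation L := (pPrimeCharType charF).
Local Notation Tr := (galTrace 1%AS {:L}%AS).

Let p_prime : prime p. Proof. exact: pcharf_prime charF. Qed.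

(** The trace is Galois-invariant, hence a scalar, so that the choice in
    [abs_trace] always succeeds. *)
Lemma abs_traceE (x : L) : (abs_trace x)%:A = Tr x.
Proof.
have /vlineP[t Tr_t] : Tr x \in 1%VS.
  by apply: mem_galTrace (memvf x); apply: finField_galois; apply: sub1v.
rewrite /abs_trace; case: pickP => [u /eqP//|/(_ t)].
by rewrite Tr_t eqxx.
Qed.

Lemma abs_trace_unique (x : L) (t : 'F_p) : Tr x = t%:A -> abs_trace x = t.
Proof. by rewrite -abs_traceE => /(fmorph_inj (in_alg L)). Qed.

Lemma abs_trace_sumZ (I : Type) (r : seq I) (c : I -> 'F_p) (x : I -> L) :
  abs_trace (\sum_(s <- r) c s *: x s) = \sum_(s <- r) c s * abs_trace (x s).
Proof.
apply: abs_trace_unique; rewrite [LHS]raddf_sum scaler_suml.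
apply: eq_bigr => s _; rewrite -scalerA abs_traceE /galTrace scaler_sumr.
by apply: eq_bigr => y _; rewrite linearZ.
Qed.

(** The Galois group is cyclic of order N, generated by x |-> x ^+ p. *)
Lemma galTrace_frobenius (N : nat) (x : L) :
  #|F| = (p ^ N)%N -> Tr x = \sum_(0 <= k < N) x ^+ (p ^ k).
Proof.
move=> cardF.
have dimL : \dim {:L} = N.
  by rewrite pprimeChar_dimf cardF pfactorK.
have [y gen_y yE] := finField_galois_generator (sub1v {:L}%AS).
have GE : 'Gal({:L} / 1)%g = <[y]>%g by apply/eqP.
have yXE k : (y ^+ k)%g x = x ^+ (p ^ k).
  elim: k => [|k IHk]; first by rewrite gal_id.
  rewrite expgSr galM ?memvf // IHk yE ?memvf //=.
  by rewrite dimv1 expn1 card_Fp // -exprM expnSr.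
have ordy : #[y]%g = N.
  rewrite orderE -GE -galois_dim ?dimv1 ?divn1 ?dimL //.
  by apply: finField_galois; apply: sub1v.
have cycE : <[y]>%g = [set (y ^+ (k : nat))%g | k : 'I_N].
  apply/setP=> u; apply/cycleP/imsetP => [[k ->]|[k _ ->]]; last by exists k.
  have N_gt0 : (0 < N)%N by rewrite -ordy.
  exists (Ordinal (ltn_pmod k N_gt0)) => //=.
  by rewrite -ordy expg_mod_order.
rewrite /galTrace GE cycE big_imset /=; last first.
  move=> j k _ _ /eqP; rewrite eq_expg_mod_order ordy !modn_small //.
  by move/eqP/val_inj.
by rewrite big_mkord; apply: eq_bigr.
Qed.

(** The exponents p ^ k of the Frobenius conjugates form a permutation of the
    residues coprime to l ^ m, which turns the trace into a Ramanujan sum. *)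
Lemma abs_trace_prim_root (l m : nat) (z : L) (t : nat) :
  prime l -> (0 < m)%N -> primitive_root_mod (l ^ m) p ->
  #|F| = (p ^ totient (l ^ m))%N -> (l ^ m).-primitive_root z ->
  abs_trace (z ^+ t) =
    (l ^ m)%:R *+ (l ^ m %| t) - (l ^ m.-1)%:R *+ (l ^ m.-1 %| t).
Proof.
move=> l_prime m_gt0 p_root cardF prim_z; apply: abs_trace_unique.
rewrite (galTrace_frobenius _ cardF).
rewrite -[RHS]/(in_alg L _) rmorphB !rmorphMn rmorph1.
rewrite -(prim_root_sum_coprime t l_prime m_gt0 prim_z).
have n_gt0 : (0 < l ^ m)%N by rewrite expn_gt0 prime_gt0.
rewrite -[RHS]big_filter /index_iota !subn0.
rewrite -(perm_big _ (primitive_root_powers_perm n_gt0 p_root)) big_map /=.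
apply: eq_bigr => k _.
by rewrite !exprM expr_mod // exprAC (prim_expr_order prim_z) expr1n.
Qed.

Lemma add_charE (R : realType) (x : L) :
  add_char R x = zeta_pow R (abs_trace x).
Proof. by rewrite /add_char /zeta_pow /zeta -expiX mulrAC. Qed.

End Trace.

(** * The character sum *)

(** Each block k * q < s <= k.+1 * q contains exactly one s with q | s + i,
    namely k.+1 * q - i. *)
Lemma sum_shifted_multiples (V : nmodType) (q l i : nat) (h : nat -> V) :
  (i < q)%N -> (forall s, ~~ (q %| s + i)%N -> h s = 0) ->
  \sum_(1 <= s < (l * q).+1) h s = \sum_(1 <= k < l.+1) h (k * q - i)%N.
Proof.
move=> lt_iq h0; rewrite !big_add1 /= big_nat_mul.
apply: eq_bigr => k _; have q_gt0 : (0 < q)%N by case: q lt_iq {h0}.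
have lt_i : (i < k.+1 * q)%N by rewrite (leq_trans lt_iq) // leq_pmull.
have s0E : (k.+1 * q - i.+1).+1 = (k.+1 * q - i)%N by rewrite subnSK.
rewrite (bigD1_seq (k.+1 * q - i.+1)%N) ?iota_uniq //=; last first.
  rewrite mem_index_iota s0E leq_subr andbT leq_subRL // mulSn.
  by rewrite leq_add2r.
rewrite s0E big_nat_cond big1 ?addr0 // => s /andP[/andP[le_s lt_s] ne_s].
apply: h0; apply: contra ne_s => /dvdnP[d sE].
have lt_kd : (k * q < d * q)%N by rewrite -sE ltnS (leq_trans le_s) ?leq_addr.
have lt_dk : (d * q < k.+2 * q)%N.
  by rewrite -sE mulSn [(s.+1 + i)%N]addnC -addSn leq_add.
rewrite !ltn_pmul2r // in lt_kd lt_dk.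
have dE : d = k.+1 by apply/eqP; rewrite eqn_leq lt_kd -ltnS lt_dk.
by rewrite -dE -sE addSnnS addnK.
Qed.

Theorem theorem2p3 (R : realType) (p l m : nat)
    (p_prime : prime p) (p_odd : odd p)
    (l_prime : prime l) (l_odd : odd l)
    (m_gt0 : (0 < m)%N)
    (p_root : primitive_root_mod (l ^ m) p)
    (F : finFieldType) (charF : p \in [pchar F])
    (cardF : #|F| = (p ^ totient (l ^ m))%N)
    (g : {unit F}) (g_gen : generator [set: {unit F}] g)
    (xi : pPrimeCharType charF)
    (xiE : xi = val g ^+ ((#|F| - 1) %/ l ^ m))
    (a : pPrimeCharType charF) (c : nat -> 'F_p)
    (aE : a = \sum_(1 <= s < (totient (l ^ m)).+1) c s *: xi ^+ s) :
  char_sum R xi (l ^ m) a =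
    \sum_(0 <= i < l ^ m.-1) e_coef R l m c i * (f_coef R l m c i + 1).
Proof.
have prim_xi : (l ^ m).-primitive_root xi.
  have prim_g := generator_prim_root g_gen.
  have n_dvd : (l ^ m %| #|F| - 1)%N.
    rewrite -eqn_mod_dvd ?cardF ?expn_gt0 ?prime_gt0 //.
    by rewrite Euler_exp_totient //; case: p_root.
  by rewrite xiE; exact: (dvdn_prim_root prim_g n_dvd).
set q := (l ^ m.-1)%N.
have q_gt0 : (0 < q)%N by rewrite expn_gt0 prime_gt0.
have nE : (l ^ m = l * q)%N by rewrite -expnS prednK.
have l_gt0 := prime_gt0 l_prime.
have totE : totient (l ^ m) = (l.-1 * q)%N by rewrite totient_pfactor.
(* The summand of index j = i + r * q; the factor of e_coef comes from the
   multiples of q, the other one from the multiples of l ^ m. *)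
have termE i r : (i < q)%N -> (r < l)%N ->
    add_char R (a * xi ^+ (i + r * q)) = e_coef R l m c i *
      (if r == 0%N then 1
       else zeta_pow R ((l ^ m)%N%:R * c ((l - r) * q - i)%N)).
  move=> lt_iq lt_rl; rewrite add_charE aE mulr_suml.
  under eq_bigr do rewrite -scalerAl -exprD.
  rewrite abs_trace_sumZ totE.
  under eq_bigr do
    rewrite (abs_trace_prim_root _ l_prime m_gt0 p_root cardF prim_xi).
  (* Only the s with q | s + i contribute; they are the k * q - i. *)
  rewrite (@sum_shifted_multiples _ _ _ i) //; last first.
    move=> s q_ndvd.
    have q_ndvd' : (q %| s + (i + r * q))%N = false.
      by rewrite addnA dvdn_addl ?dvdn_mull // (negPf q_ndvd).
    have n_ndvd : (l * q %| s + (i + r * q))%N = false.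
      by apply: contraFF q_ndvd'; apply: dvdn_trans (dvdn_mull l (dvdnn q)).
    by rewrite q_ndvd' nE n_ndvd subrr mulr0.
  rewrite prednK //.
  rewrite (eq_big_nat _ _ (F2 := fun k =>
      - (q%:R * c (k * q - i)%N) +
      (if k == (l - r)%N then (l ^ m)%N%:R * c (k * q - i)%N else 0))); last first.
    move=> k /andP[k_gt0 lt_kl].
    have le_ik : (i <= k * q)%N by rewrite (leq_trans (ltnW lt_iq)) ?leq_pmull.
    rewrite addnA subnK // -mulnDl -/q [(q %| _)%N]dvdn_mull // nE dvdn_pmul2r // -nE.
    (* Since 0 < k + r < l + l, the only possible multiple of l is l. *)
    have -> : (l %| k + r)%N = (k == l - r)%N.
      apply/idP/eqP => [/dvdnP[d]|->]; last by rewrite subnK // ltnW.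
      case: d => [|[|d]] kr.
      - by move: kr k_gt0; case: k {lt_kl le_ik}.
      - by rewrite mul1n in kr; rewrite -kr addnK.
      - have : (k + r < l + l)%N by rewrite -addSn leq_add // ltnW.
        by rewrite kr !mulSn addnA -{2}[(l + l)%N]addn0 ltn_add2l.
    by case: eqP => _; rewrite ?mulr1n ?mulr0n ?sub0r ?addr0;
      rewrite ?mulrBr ?mulrN ![c _ * _]mulrC // addrC.
  rewrite big_split zeta_powD // !zeta_pow_sum //; congr (_ * _).
  (* For r = 0 the index l - r = l lies outside of the range 1 <= k < l. *)
  case: r lt_rl => [|r] lt_rl /=.
    rewrite big_nat big1 // => k /andP[_ lt_kl].
    by rewrite subn0 (ltn_eqF lt_kl).
  rewrite (bigD1_seq (l - r.+1)%N) ?iota_uniq //=; last first.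
    by rewrite mem_index_iota subn_gt0 lt_rl ltn_subrL.
  by rewrite eqxx big1 ?mulr1 // => k /negPf->.
rewrite /char_sum nE big_nat_mul.
under eq_bigr => r _ do rewrite -{1}[(r * q)%N]add0n mulSn big_addn addnK.
rewrite exchange_big_nat /=; apply: eq_big_nat => i /andP[_ lt_iq].
rewrite (eq_big_nat _ _ (fun r lt_rl => termE i r lt_iq _)); last first.
  by move=> r /andP[].
rewrite -mulr_sumr; congr (_ * _).
rewrite big_ltn //= addrC; congr (_ + _).
(* The r-th term is the summand k = l - r of f_coef. *)
rewrite big_nat_rev; apply: eq_big_nat => r /andP[r_gt0 lt_rl].
by rewrite add1n subSS subn_eq0 leqNgt lt_rl /= subKn // ltnW.
Qed.
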